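(* Let $T$ be a finite non-abelian simple group, let $k\ge 2$, let $X\le \mathrm{Out}(T)\times S_k$, and let $G=T^k.X\le D(k,T)$ be a primitive permutation group of simple diagonal type. Let $t\in T\setminus\{1\}$, let $c=c_{X_0}(T,t)$, and let $\Gamma_0^t$ be the orbital graph of $G$ with vertex set the set of right cosets of $D_A$ in $G$ and edge set $\{D_A, D_A(1,\dots,1,t)\}^G$. Then $\mathrm{diam}(\Gamma_0^t)\ge M$, where $$M=\begin{cases}\tfrac12(k-1)c+1 & \text{if } k \text{ is odd},\\[2pt] \tfrac12 kc & \text{if } k \text{ is even}.\end{cases}$$
   Context: Simple diagonal groups. $T$ is a finite non-abelian simple group, identified with $\mathrm{Inn}(T)\le \mathrm{Aut}(T)$. Define $D(k,T)=\{(\tau_1,\dots,\tau_k).\pi : \tau_i\in \mathrm{Aut}(T),\ \pi\in S_k,\ \text{all } \tau_i \text{ lie in the same } \mathrm{Inn}(T)\text{-coset}\}\le \mathrm{Aut}(T)\,\mathrm{wr}\,S_k$; it contains $T^k$ as a normal subgroup with $D(k,T)/T^k\cong \mathrm{Out}(T)\times S_k$. For $X\le \mathrm{Out}(T)\times S_k$, $G=T^k.X$ denotes the preimage of $X$ in $D(k,T)$. Let $W=\{(\alpha,\dots,\alpha).\pi : \alpha\in \mathrm{Aut}(T),\pi\in S_k\}$ and $D_A=W\cap G$. Then $G=D_AT^k$, and $G$ acts by right multiplication on the set $\Omega=(G:D_A)$ of right cosets of $D_A$ in $G$; $G$ is a primitive group of simple diagonal type if this action is primitive. The group $X_0$. Let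 $\rho:X\to \mathrm{Out}(T)$ be the projection and $\pi:\mathrm{Aut}(T)\to \mathrm{Out}(T)$ the canonical map. Put $X_0=\pi^{-1}(\rho(X))\le \mathrm{Aut}(T)$. Widths. For a generating set $S$ of $T$, $w_S(T)$ is the minimal $m\in\mathbb N$ such that every element of $T$ is a product of at most $m$ elements of $S$. For $T\unlhd Y\le \mathrm{Aut}(T)$ and $t\in T\setminus\{1\}$, put $t^{\pm Y}=\{(t^{\alpha})^{\pm1}:\alpha\in Y\}$ and $c_Y(T,t)=w_{t^{\pm Y}}(T)$. Graphs. The notation $\{a,b\}^G$ for the edge set means the set of all images of the unordered pair $\{a,b\}$ under $G$ (an undirected graph). *)

(* Defs.v *)
From HB Require Import structures.
From mathcomp Require Import all_boot all_fingroup all_solvable.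

Set Implicit Arguments.
Unset Strict Implicit.
Unset Printing Implicit Defensive.

Import GroupScope.

Section Graph.

Variables (V : finType) (vs : {set V}) (E : {set {set V}}).

Definition adj : rel V := fun x y => [set x; y] \in E.

Definition walk n x y := [exists p : n.-tuple V, path adj x p && (last x p == y)].

(* A shortest walk has fewer than #|V| edges, so the search is exhaustive;
   the value is #|V|, larger than any actual distance, when y is not reachable
   from x. *)
Definition gdist x y := find (fun n => walk n x y) (iota 0 #|V|).

Definition diameter := \max_(x in vs) \max_(y in vs) gdist x y.

Lemma walkP n x y :
  reflect (exists p, [/\ path adj x p, last x p = y & size p = n]) (walk n x y).
Proof.
apply: (iffP existsP) => [[p /andP[ep /eqP lp]]|[p [ep lp <-]]].
  by exists p; split=> //; apply: size_tuple.
by exists (in_tuple p); rewrite ep lp eqxx.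
Qed.

Lemma gdistP x y : connect adj x y ->
  walk (gdist x y) x y /\ (forall n, walk n x y -> gdist x y <= n).
Proof.
move=> /connectP[p0 ep0 ->]; case: (shortenP ep0) => p ep up _.
have hw: has (fun n => walk n x (last x p)) (iota 0 #|V|).
  apply/hasP; exists (size p); last by apply/walkP; exists p.
  by rewrite mem_iota /= add0n -[_.+1]/(size (x :: p)) -(card_uniqP up) max_card.
have := nth_find 0 hw; have := hw; rewrite has_find size_iota => lt_d.
rewrite nth_iota // add0n => wd; split=> // n wn; rewrite leqNgt; apply/negP => ltn.
by have := before_find 0 ltn; rewrite nth_iota ?(ltn_trans ltn) // add0n wn.
Qed.

End Graph.

Section Orbital.

Variables (aT : finGroupType) (V : finType) (to : {action aT &-> V}).

Definition orbital_edges (A : {set aT}) (a b : V) : {set {set V}} :=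
  orbit to^* A [set a; b].

Lemma orbital_connected (G : {group aT}) (vs : {set V}) a b :
    [primitive G, on vs | to] -> a \in vs -> b \in vs -> a != b ->
  {in vs &, forall x y, connect (adj (orbital_edges G a b)) x y}.
Proof.
move=> primG Sa Sb nab; set e := adj _.
have trG: [transitive G, on vs | to] by case/andP: primG.
have esym: symmetric e by move=> x y; rewrite /e /adj setUC.
have csym := sym_connect_sym esym.
have eJ g x y : g \in G -> e x y -> e (to x g) (to y g).
  move=> Gg; rewrite /e /adj => /imsetP[h Gh defxy].
  apply/imsetP; exists (h * g); first exact: groupM.
  by by rewrite actM -defxy /= /setact imsetU !imset_set1.
have cJ g x y : g \in G -> connect e x y -> connect e (to x g) (to y g).
  move=> Gg /connectP[p + ->] {y}; elim: p x => [|z p IH] x /=; first by [].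
  by case/andP=> /(eJ g _ _ Gg)/connect1 h /IH; apply: connect_trans.
pose H := [set g in G | connect e a (to a g)].
have gH: group_set H.
  apply/group_setP; split=> [|g h]; first by rewrite inE group1 act1 connect0.
  rewrite !inE => /andP[Gg cg] /andP[Gh ch]; rewrite groupM //= actM.
  by apply: connect_trans ch _; apply: cJ.
move: primG; rewrite (trans_prim_astab Sa trG) => /maximal_eqP[_].
case/(_ (group gH)) => /= [||HC|HG].
- apply/subsetP=> g /setIP[Gg /astab1P ag]; by rewrite inE Gg ag connect0.
- by apply/subsetP=> g; rewrite inE => /andP[].
- have [g Gg defb] := atransP2 trG Sa Sb.
  have: g \in H.
    rewrite inE Gg -defb connect1 // /e /adj /orbital_edges orbit_refl //.
  by rewrite HC inE => /andP[_ /astab1P]; rewrite -defb => /eqP; rewrite eq_sym (negPf nab).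
have ca x : x \in vs -> connect e a x.
  move=> /(atransP2 trG Sa)[g Gg ->]; move: Gg; rewrite -HG inE.
  by case/andP.
by move=> x y Sx Sy; apply: (@connect_trans _ _ a); [rewrite csym|]; apply: ca.
Qed.

End Orbital.

Section Width.

Variable gT : finGroupType.
Implicit Types (S : {set gT}) (T : {group gT}).

(* S ^+ j is the set of all products of j elements of S. *)
Definition prods_upto S m : {set gT} := \bigcup_(j < m.+1) S ^+ j.

(* If S generates T, then every element of T is a product of fewer than #|T|
   elements of S. *)
Definition width S T := find (fun m => T \subset prods_upto S m) (iota 0 #|T|).

Lemma widthP S T : <<S>> = T ->
  T \subset prods_upto S (width S T) /\
  (forall m, T \subset prods_upto S m -> width S T <= m).
Proof.
move=> genS; pose e := [rel x y : gT | x^-1 * y \in S].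
have pathX p x : path e x p -> x^-1 * last x p \in S ^+ size p.
  elim: p x => [|y p IH] x /=; first by rewrite mulVg expg0 inE.
  case/andP=> Sy /IH Sp; rewrite expgS.
  by rewrite -[x^-1](mulgK y) -mulgA mem_mulg.
have pathT p x : x \in T -> path e x p -> {subset x :: p <= T}.
  elim: p x => [|y p IH] x Tx /=; first by move=> _ z; rewrite inE => /eqP->.
  case/andP=> Sy /IH sp z; rewrite inE => /orP[/eqP-> //|]; apply: sp.
  by rewrite -(mulKVg x y) groupM // -genS mem_gen.
have Tn : T \subset prods_upto S #|T|.-1.
  apply/subsetP=> x; rewrite -{1}genS => /gen_prodgP[n [c Sc ->]] {x}.
  suff [p ep ->]: exists2 p, path e 1 p & \prod_i c i = last 1 p.
    case: (shortenP ep) => q eq uq _; apply/bigcupP.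
    have sq: size q < #|T|.-1.+1.
      rewrite prednK ?cardG_gt0 // -[(size q).+1]/(size (1 :: q)).
      rewrite -(card_uniqP uq); apply: subset_leq_card; apply/subsetP.
      exact: pathT eq.
    by exists (Ordinal sq) => //; have := pathX _ _ eq; rewrite invg1 mul1g.
  elim: n c Sc => [|n IH] c Sc; first by exists [::]; rewrite // big_ord0.
  have [p ep lp] := IH (fun i => c (widen_ord (leqnSn n) i)) (fun i => Sc _).
  exists (rcons p (\prod_i c i)); last by rewrite last_rcons.
  rewrite rcons_path ep -lp big_ord_recr /= mulKg; exact: Sc.
have hw: has (fun m => T \subset prods_upto S m) (iota 0 #|T|).
  by apply/hasP; exists #|T|.-1 => //; rewrite mem_iota add0n /= prednK ?cardG_gt0.
have := nth_find 0 hw; have := hw; rewrite has_find size_iota => lt_d.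
rewrite nth_iota // add0n => wd; split=> // m wm; rewrite leqNgt; apply/negP => ltm.
by have := before_find 0 ltm; rewrite nth_iota ?(ltn_trans ltm) // add0n wm.
Qed.

Definition pm_orbit (Y : {set {perm gT}}) (t : gT) : {set gT} :=
  [set (a : {perm gT}) t | a in Y] :|: [set ((a : {perm gT}) t)^-1 | a in Y].

Definition cwidth (Y : {set {perm gT}}) T t := width (pm_orbit Y t) T.

End Width.

Section Wreath.

Variables (aT : finGroupType) (k : nat).

Definition base := {dffun forall _ : 'I_k, aT}.

(* Right action of 'S_k: the entry in position i is moved to position s i. *)
Definition coord_perm (f : base) (s : 'S_k) : base := [ffun i => f (s^-1 i)].

Lemma coord_perm1 : coord_perm^~ 1 =1 id.
Proof. by move=> f; apply/ffunP=> i; rewrite ffunE invg1 perm1. Qed.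

Lemma coord_permM f : act_morph coord_perm f.
Proof. by move=> s u; apply/ffunP=> i; rewrite !ffunE invMg permM. Qed.

Canonical coord_action := TotalAction coord_perm1 coord_permM.

Lemma coord_is_groupAction : is_groupAction [set: base] coord_action.
Proof.
move=> s _; rewrite inE; apply/andP; split; first by apply/subsetP=> f; rewrite inE.
apply/morphicP=> f g _ _; rewrite !actpermE; apply/ffunP=> i.
by rewrite !(ffunE, mulg_ffun).
Qed.

Canonical coord_groupAction := GroupAction coord_is_groupAction.

(* The full wreath product of aT by 'S_k. *)
Definition wreath : finGroupType := sdprod_by coord_groupAction.

(* (tau_1, ..., tau_k).pi *)
Definition wr (tau : base) (s : 'S_k) : wreath :=
  sdpair1 coord_groupAction tau * sdpair2 coord_groupAction s.

Lemma wr_inj tau s tau' s' : wr tau s = wr tau' s' -> tau = tau' /\ s = s'.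
Proof.
have E u v : pair_of_sd (wr u v) = (v, coord_perm u v).
  by rewrite /wr /= !val_insubd !inE /= mul1g mulg1.
move=> eqw; have := E tau s; rewrite eqw E => -[-> /(act_inj coord_action)].
by split.
Qed.

Lemma wrM tau s tau' s' :
  wr tau s * wr tau' s' = wr [ffun i => tau i * tau' (s i)] (s * s').
Proof.
have -> : [ffun i => tau i * tau' (s i)] = tau * coord_perm tau' s^-1.
  by apply/ffunP=> i; rewrite !ffunE invgK.
rewrite /wr sdpair1_morphM ?sdpair2_morphM ?inE //.
rewrite (sdpair_act coord_groupAction) ?inE //.
rewrite (morphV (sdpair2_morphism coord_groupAction)) ?inE //=.
by rewrite /conjg invgK !mulgA mulgKV.
Qed.

End Wreath.

Section Diagonal.

Variables (gT : finGroupType) (T : {group gT}) (k : nat).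

Definition Inn : {set {perm gT}} := conj_aut T @* T.
Canonical Inn_group := Eval hnf in [group of Inn].

Definition Out : {set coset_of Inn} := Aut T / Inn.
Canonical Out_group := Eval hnf in [group of Out].

Definition diag_base : {set base {perm gT} k} :=
  [set tau : base {perm gT} k | [forall i, tau i \in Aut T]
     && [forall i, forall j, Inn :* tau i == Inn :* tau j]].

Definition diagD : {set wreath {perm gT} k} :=
  [set wr tau s | tau in diag_base, s in [set: 'S_k]].

Lemma conj_autJ a x : a \in Aut T -> x \in T ->
  conj_aut T x ^ a = conj_aut T (a x).
Proof.
move=> Aa Tx; have Tax: a x \in T by apply: Aut_closed.
have AC y : y \in T -> conj_aut T y \in Aut T.
  by move=> Ty; rewrite (subsetP (Aut_conj_aut T T)) ?mem_morphim ?(subsetP (normG T)).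
apply: (@eq_Aut _ T); rewrite ?groupJ ?AC // => y Ty.
have Tz: a^-1 y \in T by rewrite Aut_closed ?groupV.
rewrite /conjg !permM !conj_autE // -!(autmE Aa) !(morphM, morphV, groupM, groupV) //=.
by rewrite !autmE permKV.
Qed.

Lemma Inn_normal : Inn <| Aut T.
Proof.
rewrite /normal Aut_conj_aut; apply/subsetP=> a Aa; rewrite inE.
apply/subsetP=> _ /imsetP[_ /morphimP[x _ Tx ->] ->].
have aT: a x \in T by rewrite Aut_closed.
by rewrite conj_autJ // mem_morphim // (subsetP (normG T)).
Qed.

Variable X : {group coset_of Inn * 'S_k}.

(* G = T^k.X, the preimage of X under the map from D(k,T) to Out(T) x S_k
   sending (tau_1, ..., tau_k).pi to the pair of the common class of the tau_i
   and pi. *)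
Definition diagG : {set wreath {perm gT} k} :=
  [set wr tau s | tau in diag_base, s in [set: 'S_k]
     & [forall i, (coset Inn (tau i), s) \in X]].

Definition diagW : {set wreath {perm gT} k} :=
  [set wr [ffun => a] s | a in Aut T, s in [set: 'S_k]].

Definition diagA : {set wreath {perm gT} k} := diagW :&: diagG.

Lemma diag_baseP (tau : base {perm gT} k) :
  reflect ((forall i, tau i \in Aut T) /\
           (forall i j, Inn :* tau i = Inn :* tau j)) (tau \in diag_base).
Proof.
rewrite inE; apply: (iffP andP) => -[At Et]; split.
- exact/forallP.
- by move=> i j; apply/eqP; apply: (forallP (forallP Et i) j).
- exact/forallP.
- by apply/forallP=> i; apply/forallP=> j; apply/eqP.
Qed.

Lemma diagGP w :
  reflect (exists tau s, [/\ tau \in diag_base,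
             forall i, (coset Inn (tau i), s) \in X & w = wr tau s])
          (w \in diagG).
Proof.
apply: (iffP imset2P) => [[tau s Bt]|[tau [s [Bt Xt ->]]]].
  by rewrite !inE /= => /forallP Xt ->; exists tau, s.
by exists tau s; rewrite // !inE /=; apply/forallP.
Qed.

Lemma diagG_sub : diagG \subset diagD.
Proof.
by apply/subsetP=> w /diagGP[tau [s [Bt _ ->]]]; apply: imset2_f; rewrite ?in_setT.
Qed.

Lemma diagG_group_set : group_set diagG.
Proof.
have nInn a : a \in Aut T -> a \in 'N(Inn) by apply/subsetP/normal_norm/Inn_normal.
apply/group_setP; split.
  apply/diagGP; exists 1, 1; split; last by rewrite /wr !morph1 mulg1.
    by apply/diag_baseP; split=> [i|i j]; rewrite !oneg_ffun ?group1.
  by move=> i; rewrite oneg_ffun morph1 group1.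
move=> w w' /diagGP[tau [s [/diag_baseP[At Et] Xt ->]]].
move=> /diagGP[tau' [s' [/diag_baseP[At' Et'] Xt' ->]]].
rewrite wrM; apply/diagGP; exists [ffun i => tau i * tau' (s i)], (s * s').
split=> //; last first.
  move=> i; rewrite ffunE morphM ?nInn //.
  exact: (groupM (Xt i) (Xt' (s i))).
apply/diag_baseP; split=> [i|i j]; rewrite !ffunE ?groupM //.
by rewrite -!rcoset_mul ?nInn // (Et i j) (Et' (s i) (s j)).
Qed.
Canonical diagG_group := Group diagG_group_set.

Lemma diagW_group_set : group_set diagW.
Proof.
apply/group_setP; split.
  apply/imset2P; exists 1 1; rewrite ?group1 ?in_setT //.
  transitivity (wr (1 : base {perm gT} k) 1); first by rewrite /wr !morph1 mulg1.
  by congr wr; apply/ffunP=> i; rewrite !ffunE.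
move=> _ _ /imset2P[a s Aa _ ->] /imset2P[b u Ab _ ->].
rewrite wrM; apply/imset2P; exists (a * b) (s * u); rewrite ?groupM ?in_setT //.
by congr wr; apply/ffunP=> i; rewrite !ffunE.
Qed.
Canonical diagW_group := Group diagW_group_set.
Canonical diagA_group := Eval hnf in [group of diagA].

Definition X0 : {set {perm gT}} :=
  [set a in Aut T | coset Inn a \in [set x.1 | x in X]].

(* (1, ..., 1, t), with t in T identified with the inner automorphism it
   induces. *)
Definition last_elt (t : gT) : wreath {perm gT} k :=
  wr [ffun i : 'I_k => if i.+1 == k then conj_aut T t else 1] 1.

Lemma last_elt_notin t : 1 < k -> simple T -> ~~ abelian T -> t \in T^# ->
  last_elt t \notin diagA.
Proof.
move=> k1 sT nabT /setD1P[nt Tt]; apply/negP=> /setIP[/imset2P[a s _ _ + ] _].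
have k0: 0 < k by apply: ltnW.
have kk: k.-1 < k by rewrite prednK.
case/wr_inj=> /ffunP E _; move: (E (Ordinal k0)) (E (Ordinal kk)).
rewrite !ffunE /= prednK // eqxx (ltn_eqF k1) => <- ct.
have: t \in 'ker (conj_aut T) by apply/kerP; rewrite ?(subsetP (normG T)).
rewrite ker_conj_aut => Ct.
have Zt: t \in 'Z(T) by rewrite inE Tt.
have [_ /(_ _ (center_normal T))[Z1|ZT]] := simpleP _ sT.
  by move: Zt; rewrite Z1 inE (negPf nt).
by case/negP: nabT; apply/center_idP.
Qed.

Lemma diagA_neq t : 1 < k -> simple T -> ~~ abelian T -> t \in T^# ->
  diagA :!=: diagA :* last_elt t.
Proof.
move=> k1 sT nabT Tt; apply: contraNneq (last_elt_notin k1 sT nabT Tt) => ->.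
exact: rcoset_refl.
Qed.

End Diagonal.

Arguments diag_base {gT} T k.
Arguments diagD {gT} T k.
Arguments diagG {gT} T {k} X.
Arguments diagW {gT} T k.
Arguments diagA {gT} T {k} X.
Arguments X0 {gT} T {k} X.
Arguments last_elt {gT} T k t.

Lemma pm_orbit_gen (gT : finGroupType) (T : {group gT}) (Y : {set {perm gT}}) t :
    simple T -> Inn T \subset Y -> Y \subset Aut T -> t \in T^# ->
  <<pm_orbit Y t>> = T.
Proof.
move=> sT /subsetP IY /subsetP YA /setD1P[nt Tt].
have sPT: pm_orbit Y t \subset T.
  by apply/subsetP=> _ /setUP[] /imsetP[a /YA Aa ->]; rewrite ?groupV Aut_closed.
have clT x : x \in T -> t ^ x \in pm_orbit Y t.
  move=> Tx; apply/setUP; left; apply/imsetP; exists (conj_aut T x).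
    by rewrite IY // mem_morphim // (subsetP (normG T)).
  by rewrite conj_autE.
have sC: t ^: T \subset <<pm_orbit Y t>>.
  by apply/subsetP=> _ /imsetP[x Tx ->]; rewrite mem_gen ?clT.
apply/eqP; rewrite eqEsubset gen_subG sPT /=.
have nC: <<t ^: T>> <| T.
  by rewrite /normal gen_subG class_subG //= norms_gen ?class_norm.
have [_ /(_ _ nC)[C1|<-]] := simpleP _ sT; last by rewrite gen_subG.
have: t \in <<t ^: T>> by rewrite mem_gen ?class_refl.
by rewrite C1 inE (negPf nt).
Qed.

(* Main.v *)
Require Import Defs.
From mathcomp Require Import all_boot all_fingroup all_solvable.

Set Implicit Arguments.
Unset Strict Implicit.
Unset Printing Implicit Defensive.

Import GroupScope.

(** Since [G = D_A T^k], every vertex is a coset [D_A (f_1, ..., f_k)] with all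
    [f_i] in [T], and the tuple is determined up to left multiplication of all
    entries by one element of [T].  Conjugating [(1, ..., 1, t)] by an element
    of [D_A] moves [t] to another position and replaces it by some [t^alpha]
    with [alpha] in [X_0]; hence (lemma [adj_tuple_vertex]) an edge multiplies a
    single entry by an element of [S = t^{+-X_0}].  So if [D_A w] is at distance
    [n] from [D_A], there is [a] in [T] such that [a w_i] is a product of [m_i]
    elements of [S], with [m_1 + ... + m_k = n] (lemmas [path_word_sum] and
    [tuple_vertex_inj]).

    It remains to choose [w].  By minimality of [c], some [x] in [T] is not a
    product of fewer than [c] elements of [S].  If two entries of [w] are [1] and
    [x], then [x = a^-1 (a x)] forces [m_i + m_j >= c], because [S = S^-1] (lemma
    [pair_cost]).  Alternating [1] and [x] settles the even case (lemma
    [even_cost]), and gives [(k-1)c/2] from the first [k - 1] entries in the odd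
    case.  The summand [+1] of the odd case comes from taking [x x'^-1] as the
    last entry, where [x' != x] is a conjugate of [x]; it exists because [T] has
    trivial centre.  If the last entry of [a w] is nontrivial, it costs at least
    one factor.  Otherwise [a = x' x^-1] is nontrivial and [a x = x'] needs [c]
    factors just as [x] does, since [S] is normalised by [T]; so each pair
    already costs at least [c + 1] (lemma [odd_cost]).

    Primitivity enters through the connectedness of the graph, which makes the
    distance between the two chosen vertices the length of an actual path. *)

(** * Products of elements of a normal symmetric set *)

Section Words.

Variable gT : finGroupType.
Implicit Types (S : {set gT}) (T : {group gT}).

Lemma prods_uptoP S m x :
  reflect (exists2 j, j <= m & x \in S ^+ j) (x \in prods_upto S m).
Proof.
apply: (iffP bigcupP) => [[j _ Sx]|[j le_jm Sx]].
  by exists j; rewrite // -ltnS.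
by exists (Ordinal (le_jm : j < m.+1)).
Qed.

Lemma expsgV S n x : S^-1 = S -> (x^-1 \in S ^+ n) = (x \in S ^+ n).
Proof. by move=> SV; rewrite -mem_invg -expVgn SV. Qed.

Lemma expsg_norm S n T : T \subset 'N(S) -> T \subset 'N(S ^+ n).
Proof.
move=> nST; elim: n => [|n IH]; first by rewrite expg0 norms1.
by rewrite expgS normsM.
Qed.

Lemma expsgJ S n T x y :
  T \subset 'N(S) -> y \in T -> (x ^ y \in S ^+ n) = (x \in S ^+ n).
Proof.
move=> nST Ty; rewrite -{1}(normsP (expsg_norm n nST) y Ty).
by rewrite memJ_conjg.
Qed.

(** For [T != 1] the width is positive, so by minimality the products of one
    factor less miss some [x], and [x] cannot be the empty product. *)
Lemma width_attained S T : T :!=: 1 -> <<S>> = T ->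
  exists x, [/\ x \in T, x != 1 & forall j, x \in S ^+ j -> width S T <= j].
Proof.
move=> ntT /widthP[TS minw].
have w_gt0: 0 < width S T.
  rewrite lt0n; apply: contraNneq ntT => w0.
  rewrite -subG1; apply: subset_trans TS _; apply/subsetP=> x; rewrite w0.
  by case/prods_uptoP=> j; rewrite leqn0 => /eqP->.
have /subsetPn[x Tx nSx]: ~~ (T \subset prods_upto S (width S T).-1).
  by apply: contraL w_gt0 => /minw; case: (width S T) => // w; rewrite ltnn.
have cx j: x \in S ^+ j -> width S T <= j.
  move=> Sx; rewrite leqNgt; apply: contra nSx => lt_jw.
  by apply/prods_uptoP; exists j; rewrite // -ltnS prednK.
exists x; split=> //; apply: contraTneq w_gt0 => x1.
by rewrite -leqNgt cx // x1 expg0 inE.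
Qed.

Lemma nontrivial_conj T x : 'Z(T) = 1 -> x \in T -> x != 1 ->
  exists2 y, y \in T & x ^ y != x.
Proof.
move=> Z1 Tx ntx; have: x \notin 'C(T).
  apply: contra ntx => Cx; have: x \in 'Z(T) by rewrite inE Tx.
  by rewrite Z1 inE.
rewrite -sub1set -[[set x] \subset _]centsC => /subsetPn[y Ty nCy].
exists y => //; apply: contra nCy => /eqP xy.
rewrite cent_set1; apply/cent1P/commute_sym.
by apply/commgP/conjg_fixP.
Qed.

End Words.

Lemma sum_pairs (b h : nat) (m : nat -> nat) :
    (forall j, j < h -> b <= m j.*2 + m j.*2.+1) ->
  h * b <= \sum_(0 <= i < h.*2) m i.
Proof.
elim: h => [|h IH] le_b; first by rewrite mul0n.
rewrite doubleS !big_nat_recr //= mulSn addnC -addnA leq_add ?le_b //.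
by apply: IH => j lt_jh; rewrite le_b // ltnW.
Qed.

(** * The connection set *)

Section ConnectionSet.

Variables (gT : finGroupType) (T : {group gT}) (k : nat).
Variables (X : {group coset_of (Inn T) * 'S_k}) (t : gT).

Lemma conj_aut_Inn x : x \in T -> conj_aut T x \in Inn T.
Proof. by move=> Tx; rewrite mem_morphim // (subsetP (normG T)). Qed.

Lemma conj_aut_Aut x : x \in T -> conj_aut T x \in Aut T.
Proof. by move/conj_aut_Inn; apply/subsetP/normal_sub/Inn_normal. Qed.

Lemma conj_aut_inj : 'Z(T) = 1 -> {in T &, injective (conj_aut T)}.
Proof.
move=> Z1 x y Tx Ty exy; apply/eqP; rewrite eq_mulgV1.
suff: x * y^-1 \in 'Z(T) by rewrite Z1 inE.
have NT := subsetP (normG T); have Txy: x * y^-1 \in T by rewrite groupM ?groupV.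
rewrite inE Txy -ker_conj_aut; apply/kerP; first exact: NT.
by rewrite morphM ?morphV ?NT ?groupV //= exy mulgV.
Qed.

Lemma X0P a : reflect (a \in Aut T /\ exists s, (coset (Inn T) a, s) \in X)
                      (a \in X0 T X).
Proof.
apply: (iffP setIdP) => -[Aa].
  by case/imsetP=> -[b s] Xbs /= ->; split=> //; exists s.
by case=> s Xas; split=> //; apply/imsetP; exists (coset (Inn T) a, s).
Qed.

Lemma Inn_sub_X0 : Inn T \subset X0 T X.
Proof.
apply/subsetP=> a Ia; apply/X0P.
split; first by apply: subsetP Ia; apply/normal_sub/Inn_normal.
by exists 1; rewrite coset_id //; apply: group1.
Qed.

(** [X_0] is a union of [Inn T]-cosets; this is what makes [t^{+-X_0}] normal
    in [T]. *)
Lemma X0_mul_Inn a x : a \in X0 T X -> x \in T -> a * conj_aut T x \in X0 T X.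
Proof.
have nInn b : b \in Aut T -> b \in 'N(Inn T).
  exact/subsetP/normal_norm/Inn_normal.
case/X0P=> Aa [s Xas] Tx; apply/X0P; rewrite groupM ?conj_aut_Aut //.
split=> //; exists s.
rewrite morphM ?nInn ?conj_aut_Aut //=.
by rewrite (@coset_id _ _ (conj_aut T x)) ?conj_aut_Inn // mulg1.
Qed.

Local Notation S := (pm_orbit (X0 T X) t).

Lemma mem_pm_orbit a : a \in X0 T X -> a t \in S.
Proof. by move=> Xa; apply/setUP; left; apply/imsetP; exists a. Qed.

Lemma mem_pm_orbitV a : a \in X0 T X -> (a t)^-1 \in S.
Proof. by move=> Xa; apply/setUP; right; apply/imsetP; exists a. Qed.

Lemma pm_orbit_inv : S^-1 = S.
Proof.
apply/setP=> x; rewrite mem_invg; have h y : y \in S -> y^-1 \in S.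
  case/setUP=> /imsetP[a Xa ->]; first exact: mem_pm_orbitV.
  by rewrite invgK mem_pm_orbit.
by apply/idP/idP=> /h; rewrite ?invgK.
Qed.

Lemma pm_orbit_norm : t \in T -> T \subset 'N(S).
Proof.
move=> Tt; apply/subsetP=> x Tx; rewrite inE; apply/subsetP=> _ /imsetP[y Sy ->].
have E a : a \in X0 T X -> (a t) ^ x = (a * conj_aut T x) t.
  by case/X0P=> Aa _; rewrite permM conj_autE ?Aut_closed.
case/setUP: Sy => /imsetP[a Xa ->]; rewrite ?conjVg E //.
  by rewrite mem_pm_orbit ?X0_mul_Inn.
by rewrite mem_pm_orbitV ?X0_mul_Inn.
Qed.

End ConnectionSet.

(** * Vertices as tuples, and the edges between them *)

Section TupleVertices.

Variables (gT : finGroupType) (T : {group gT}) (k : nat).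
Variables (X : {group coset_of (Inn T) * 'S_k}) (t : gT).

Local Notation S := (pm_orbit (X0 T X) t).

(** The entries are indexed by [nat] rather than by ['I_k], so that positions
    can later be paired by arithmetic on indices; only those below [k] count. *)
Definition inn_tuple (f : nat -> gT) : wreath {perm gT} k :=
  wr [ffun i : 'I_k => conj_aut T (f i)] 1.

Definition tuple_vertex f : {set wreath {perm gT} k} := diagA T X :* inn_tuple f.

Lemma last_eltE y :
  last_elt T k y = inn_tuple (fun i => if i.+1 == k then y else 1).
Proof.
congr wr; apply/ffunP=> i; rewrite !ffunE; case: ifP => // _.
by rewrite morph1.
Qed.

Lemma inn_tuple1 : inn_tuple (fun=> 1) = 1.
Proof.
rewrite /inn_tuple; suff -> : [ffun=> conj_aut T 1] = 1 :> base {perm gT} k.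
  by rewrite /wr !morph1 mul1g.
by apply/ffunP=> i; rewrite ffunE morph1 oneg_ffun.
Qed.

Lemma inn_tupleM f g : (forall i, f i \in T) -> (forall i, g i \in T) ->
  inn_tuple f * inn_tuple g = inn_tuple (fun i => f i * g i).
Proof.
move=> Tf Tg; rewrite wrM mulg1; congr wr; apply/ffunP=> i; rewrite !ffunE perm1.
by rewrite morphM ?(subsetP (normG T)).
Qed.

Lemma eq_inn_tuple f g : f =1 g -> inn_tuple f = inn_tuple g.
Proof. by move=> efg; congr wr; apply/ffunP=> i; rewrite !ffunE efg. Qed.

Lemma last_eltV y : y \in T -> last_elt T k y^-1 = (last_elt T k y)^-1.
Proof.
move=> Ty; have Ti z : z \in T -> forall i, (if i.+1 == k then z else 1) \in T.
  by move=> Tz i; case: ifP.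
apply/eqP; rewrite eq_sym eq_invg_mul; apply/eqP.
rewrite !last_eltE inn_tupleM; [|exact: Ti|by apply: Ti; rewrite groupV].
rewrite -inn_tuple1; apply: eq_inn_tuple => i.
by case: ifP; rewrite ?mulgV ?mulg1.
Qed.

Lemma inn_tuple_diagG f : (forall i, f i \in T) -> inn_tuple f \in diagG T X.
Proof.
move=> Tf; apply/diagGP; eexists; exists 1; split; last by [].
  apply/diag_baseP; split=> [i|i j]; rewrite !ffunE ?conj_aut_Aut //.
  by rewrite !rcoset_id ?conj_aut_Inn.
by move=> i; rewrite ffunE coset_id ?conj_aut_Inn //; apply: group1.
Qed.

Lemma diagAP d : 0 < k -> d \in diagA T X ->
  exists a s, a \in X0 T X /\ d = wr [ffun=> a] s.
Proof.
move=> k_gt0 /setIP[/imset2P[a s Aa _ ->] /diagGP[tau [u [_ Xtau]]]].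
case/wr_inj=> ea es; exists a, s; split=> //; apply/X0P; split=> //; exists s.
by move: (Xtau (Ordinal k_gt0)); rewrite -ea -es ffunE.
Qed.

(** The automorphism in [d] twists [y], and the permutation in [d] decides which
    entry is affected. *)
Lemma last_elt_mul_diagA d f y : 0 < k -> y \in T -> (forall i, f i \in T) ->
    d \in diagA T X ->
  exists a j, [/\ a \in X0 T X, j < k
    & diagA T X :* (last_elt T k y * d * inn_tuple f)
      = tuple_vertex (fun i => if i == j then a y * f i else f i)].
Proof.
move=> k_gt0 Ty Tf Ad; have [a [s [Xa ed]]] := diagAP k_gt0 Ad.
have [Aa _] := X0P _ _ Xa; have Tay: a y \in T by rewrite Aut_closed.
have kk: k.-1 < k by rewrite prednK.
exists a, (s (Ordinal kk)); split=> //.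
pose g i := if i == val (s (Ordinal kk)) then a y else 1.
have Tg i : g i \in T by rewrite /g; case: ifP.
have -> : last_elt T k y * d = d * inn_tuple g.
  rewrite ed !wrM mul1g mulg1; congr wr; apply/ffunP=> i; rewrite !ffunE /g.
  have -> : (s i == s (Ordinal kk) :> nat) = (i.+1 == k).
    by rewrite val_eqE (inj_eq perm_inj) -val_eqE /= -eqSS prednK.
  case: ifP => _; last by rewrite morph1 mul1g mulg1.
  by rewrite -conj_autJ // /conjg !mulgA mulgV mul1g.
rewrite -mulgA inn_tupleM // rcosetM rcoset_id // /tuple_vertex.
congr (_ :* _); apply: eq_inn_tuple => i; rewrite /g.
by case: ifP; rewrite ?mul1g.
Qed.

Local Notation edges :=
  (orbital_edges 'Rs (diagG T X) (diagA T X) (diagA T X :* last_elt T k t)).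

(** An edge may be traversed in either orientation, which is why [S] contains
    the images of both [t] and [t^-1]. *)
Lemma adj_tuple_vertex f v : 0 < k -> t \in T -> (forall i, f i \in T) ->
    adj edges (tuple_vertex f) v ->
  exists x j, [/\ x \in S, j < k
    & v = tuple_vertex (fun i => if i == j then x * f i else f i)].
Proof.
move=> k_gt0 Tt Tf /imsetP[g Gg].
rewrite /= /setact imsetU !imset_set1 /= !rcosetE -rcosetM => /setP e.
suff [y [d [Ad ey ->]]]: exists y d,
    [/\ d \in diagA T X, (y == t) || (y == t^-1)
      & v = diagA T X :* (last_elt T k y * d * inn_tuple f)].
  have Ty: y \in T by case/orP: ey => /eqP->; rewrite ?groupV.
  have [a [j [Xa lt_jk ->]]] := last_elt_mul_diagA k_gt0 Ty Tf Ad.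
  exists (a y), j; split=> //; case/orP: ey => /eqP->; first exact: mem_pm_orbit.
  have [Aa _] := X0P _ _ Xa; rewrite -(autmE Aa) morphV //= autmE.
  exact: mem_pm_orbitV.
have other u w : tuple_vertex f = u ->
    [set tuple_vertex f; v] =i [set u; w] -> v = w.
  move=> <- {}e; have := e w; rewrite !inE eqxx orbT => /orP[]/eqP // ew.
  by have := e v; rewrite ew !inE eqxx orbT orbb => /esym/eqP.
have := e (tuple_vertex f); rewrite !inE eqxx /= => /esym/orP[]/eqP eu.
  have: g \in tuple_vertex f by rewrite eu rcoset_refl.
  case/rcosetP=> d Ad eg; exists t, d; rewrite eqxx; split=> //.
  by rewrite (other _ _ eu e) eg mulgA.
have: last_elt T k t * g \in tuple_vertex f by rewrite eu rcoset_refl.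
case/rcosetP=> d Ad eg; exists t^-1, d; rewrite eqxx orbT; split=> //.
rewrite last_eltV // -mulgA -eg mulKg; apply: (other _ _ eu) => u.
by rewrite e setUC.
Qed.

(** The edge at the [j]-th entry spends one more factor there, so the total
    number of factors over all entries is the length of the path. *)
Lemma path_word_sum (p : seq {set wreath {perm gT} k}) :
    0 < k -> t \in T -> path (adj edges) (diagA T X : {set _}) p ->
  exists f m, [/\ forall i, f i \in T, forall i, f i \in S ^+ m i,
     \sum_(0 <= i < k) m i = size p
   & last (diagA T X : {set _}) p = tuple_vertex f].
Proof.
move=> k_gt0 Tt; elim/last_ind: p => [|p v IH].
  exists (fun=> 1), (fun=> 0); split=> //=; first by rewrite big1.
  by rewrite /tuple_vertex inn_tuple1 mulg1.
rewrite rcons_path last_rcons size_rcons => /andP[/IH[f [m [Tf Sf sum_m ->]]]].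
case/(adj_tuple_vertex k_gt0 Tt Tf)=> x [j [Sx lt_jk ->]].
have Tx: x \in T.
  by case/setUP: Sx => /imsetP[a /X0P[Aa _] ->]; rewrite ?groupV Aut_closed.
exists (fun i => if i == j then x * f i else f i), (fun i => (i == j) + m i)%N.
split=> // [i|i|].
- by case: ifP; rewrite ?groupM.
- by case: ifP => // _; rewrite expgS mem_mulg.
rewrite big_split /= sum_m -add1n; congr (_ + _)%N.
rewrite big_mkord (bigD1 (Ordinal lt_jk)) //= eqxx big1 ?addn0 // => i.
by rewrite -val_eqE /= => /negPf->.
Qed.

(** Two elements of [T^k] in the same coset differ by an element of [D_A] with
    trivial permutation part, hence by a constant tuple on the left.  The
    constant is read off at position [0], and a trivial centre lets the
    comparison pass from inner automorphisms back to [T]. *)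
Lemma tuple_vertex_inj f w : 'Z(T) = 1 -> 0 < k ->
    (forall i, f i \in T) -> (forall i, w i \in T) ->
    tuple_vertex f = tuple_vertex w ->
  forall i, i < k -> f i = f 0 * (w 0)^-1 * w i.
Proof.
move=> Z1 k_gt0 Tf Tw efw.
have: inn_tuple f \in tuple_vertex w by rewrite -efw rcoset_refl.
case/rcosetP=> d /(diagAP k_gt0)[a [s [_ ->]]]; rewrite wrM mulg1.
case/wr_inj=> /ffunP E s1 i lt_ik; have NT := subsetP (normG T).
have ef j (lt_jk : j < k) : conj_aut T (f j) = a * conj_aut T (w j).
  by move: (E (Ordinal lt_jk)); rewrite !ffunE -s1 perm1.
apply: (conj_aut_inj Z1); rewrite ?groupM ?groupV //.
rewrite !morphM ?morphV ?NT ?groupM ?groupV //=.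
by rewrite (ef i) // (ef 0) // mulgK.
Qed.

End TupleVertices.

(** * A vertex far from the base vertex *)

Section FarTuple.

Variables (gT : finGroupType) (T : {group gT}) (S : {set gT}) (c : nat).

(** In odd length one entry stays unpaired; it becomes trivial for the single
    multiplier [y^-1], so the choice of [y] decides which multiplier gets it for
    free. *)
Definition alternating k (x y : gT) i :=
  if odd k && (i.+1 == k) then y else if odd i then x else 1.

Hypotheses (SV : S^-1 = S) (nST : T \subset 'N(S)).
Variable x : gT.
Hypothesis le_cx : forall j, x \in S ^+ j -> c <= j.

(** Whatever the common multiplier [a], a pair of entries [1] and [x] becomes
    [a] and [a * x], whose quotient is still [x]. *)
Lemma pair_cost a i j : a \in S ^+ i -> a * x \in S ^+ j -> c <= i + j.
Proof.
by move=> Sa Sax; apply: le_cx; rewrite -(mulKg a x) expgD mem_mulg // expsgV.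
Qed.

Lemma even_cost k y a m : ~~ odd k ->
    (forall i, i < k -> a * alternating k x y i \in S ^+ m i) ->
  (k * c)./2 <= \sum_(0 <= i < k) m i.
Proof.
move=> ev_k; rewrite -[k]odd_double_half (negPf ev_k) add0n => Sm.
rewrite -doubleMl doubleK; apply: sum_pairs => j lt_jh.
move: (Sm j.*2) (Sm j.*2.+1).
rewrite /alternating odd_double /= odd_double /= mulg1.
rewrite ltn_double ltn_Sdouble => /(_ lt_jh) Sa /(_ lt_jh).
exact: pair_cost.
Qed.

(** The unpaired entry is free only when [a = x ^ z * x^-1]; then each pair of
    entries is [a] and [x ^ z], which wastes the factors spent on [a]. *)
Lemma odd_cost k z a m : odd k -> 2 <= k -> z \in T -> x ^ z != x ->
    (forall i, i < k -> a * alternating k x (x * (x ^ z)^-1) i \in S ^+ m i) ->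
  ((k - 1) * c)./2 + 1 <= \sum_(0 <= i < k) m i.
Proof.
move=> odd_k; rewrite -[k]odd_double_half odd_k add1n.
set h := k./2 => h2 Tz xz Sm; have h_gt0: 0 < h by case: (h) h2.
have pairs j : j < h -> a \in S ^+ m j.*2 /\ a * x \in S ^+ m j.*2.+1.
  move=> lt_jh; move: (Sm j.*2) (Sm j.*2.+1).
  rewrite /alternating !eqSS /= !odd_double /=.
  have -> : (j.*2 == h.*2) = false by rewrite (inj_eq double_inj) ltn_eqF.
  have -> : (j.*2.+1 == h.*2) = false by rewrite ltn_eqF // ltn_Sdouble.
  rewrite mulg1 !ltnS leq_double (ltnW lt_jh) ltn_double lt_jh.
  by move=> Sa Sax; split; [apply: Sa | apply: Sax].
rewrite subn1 /= -doubleMl doubleK big_nat_recr //=.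
have [m0|m_gt0] := posnP (m h.*2); last first.
  apply: leq_add m_gt0; apply: sum_pairs => j /pairs[Sa Sax].
  exact: pair_cost Sa Sax.
have ea: a = x ^ z * x^-1.
  have := Sm h.*2 (leqnn _).
  rewrite /alternating eqxx /= odd_double m0 expg0 inE => /eqP a1.
  by rewrite -[a](mulgK (x * (x ^ z)^-1)) a1 mul1g invMg invgK.
have nta: a != 1 by rewrite ea -eq_mulgV1.
rewrite m0 addn0 (@leq_trans (h * c.+1)) //.
  by rewrite mulnS addnC leq_add2r.
apply: sum_pairs => j /pairs[Sa]; rewrite {1}ea mulgKV => Sxz.
rewrite -add1n leq_add //.
  by rewrite lt0n; apply: contraNneq nta => m1; rewrite m1 expg0 inE in Sa.
by apply: le_cx; rewrite -(expsgJ _ x nST Tz).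
Qed.

End FarTuple.

(* Both halvings below are exact. *)
Theorem theorem3p1 (gT : finGroupType) (T : {group gT}) (k : nat)
    (X : {group coset_of (Inn T) * 'S_k}) (t : gT)
    (simT : simple T) (nabT : ~~ abelian T) (k_ge2 : 2 <= k)
    (sXOS : X \subset setX (Out T) [set: 'S_k])
    (primG : [primitive diagG T X, on rcosets (diagA T X) (diagG T X) | 'Rs])
    (Tt : t \in T^#) :
  let G := diagG T X in
  let DA := diagA T X in
  let c := cwidth (X0 T X) T t in
  let Gamma := orbital_edges 'Rs G DA (DA :* last_elt T k t) in
  (if odd k then ((k - 1) * c)./2 + 1 else (k * c)./2)%N
    <= diameter (rcosets DA G) Gamma.
Proof.
cbv zeta; set Gamma := orbital_edges _ _ _ _; set c := cwidth _ _ _.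
set G := diagG T X in Gamma *; set DA := diagA T X in Gamma *.
have [_ Tt1] := setD1P Tt; have k_gt0: 0 < k by apply: ltnW.
have Z1: 'Z(T) = 1.
  have [_ /(_ _ (center_normal T))[//|ZT]] := simpleP _ simT.
  by case/negP: nabT; apply/center_idP.
have ntT: T :!=: 1 by apply: contraNneq nabT => ->; apply: abelian1.
have genS: <<pm_orbit (X0 T X) t>> = T.
  apply: pm_orbit_gen => //; first exact: Inn_sub_X0.
  by apply/subsetP=> a /X0P[].
have SV := pm_orbit_inv X t; have nST := pm_orbit_norm X Tt1.
have [x [Tx ntx cx]] := width_attained ntT genS.
have [z Tz xz] := nontrivial_conj Z1 Tx ntx.
pose w := alternating k x (x * (x ^ z)^-1).
have Tw i : w i \in T.
  by rewrite /w /alternating; do !case: ifP => _; rewrite ?groupM ?groupV ?groupJ.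
have V0 : (DA : {set _}) \in rcosets DA G.
  by apply/rcosetsP; exists 1; rewrite ?group1 ?mulg1.
have Vf f : (forall i, f i \in T) -> tuple_vertex X f \in rcosets DA G.
  by move=> Tf; apply/rcosetsP; exists (inn_tuple T k f); rewrite ?inn_tuple_diagG.
have conn : connect (adj Gamma) DA (tuple_vertex X w).
  apply: (orbital_connected primG) => //; rewrite ?Vf ?diagA_neq //.
  by rewrite last_eltE; apply: Vf => i; case: ifP.
have [/walkP[p [ep lp szp]] _] := gdistP conn.
have le_diam : gdist Gamma DA (tuple_vertex X w) <= diameter (rcosets DA G) Gamma.
  rewrite /diameter (bigD1 (DA : {set _})) //= leq_max; apply/orP; left.
  by rewrite (bigD1 (tuple_vertex X w)) ?leq_maxl // Vf.
apply: leq_trans le_diam; rewrite -szp.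
have [f [m [Tf Sf <- elast]]] := path_word_sum k_gt0 Tt1 ep.
have ef := tuple_vertex_inj Z1 k_gt0 Tf Tw (etrans (esym elast) lp).
have Sm i : i < k -> f 0 * (w 0)^-1 * w i \in pm_orbit (X0 T X) t ^+ m i.
  by move=> /ef <-.
case: ifPn => odd_k; first exact: (odd_cost SV nST cx odd_k k_ge2 Tz xz Sm).
exact: (even_cost SV cx odd_k Sm).
Qed.
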